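(* For all $n\ge 2$, the monoid $\mathcal{DORP}_n$ is abundant.
   Context: Let $[n]=\{1,\dots,n\}$ with its usual order. A partial transformation of $[n]$ is a function $\rho$ whose domain $\mathrm{Dom}\,\rho$ and image $\mathrm{Im}\,\rho$ are subsets of $[n]$ (the empty map is allowed). Maps are written on the right and composed left to right: $x(\rho\sigma)=(x\rho)\sigma$. $\rho$ is isotone if $x\le y$ implies $x\rho\le y\rho$ for all $x,y\in\mathrm{Dom}\,\rho$; antitone if $x\le y$ implies $x\rho\ge y\rho$; monotone if isotone or antitone; decreasing if $x\rho\le x$ for all $x\in\mathrm{Dom}\,\rho$. $\mathcal{DORP}_n$ is the monoid, under composition, of all monotone and decreasing partial transformations of $[n]$. On a semigroup $S$, $\mathcal{L}^*=\{(a,b)\in S\times S:\ \forall x,y\in S^1,\ ax=ay\iff bx=by\}$ and $\mathcal{R}^*=\{(a,b)\in S\times S:\ \forall x,y\in S^1,\ xa=ya\iff xb=yb\}$. A semigroup is regular if for every $x\in S$ there is $y\in S$ with $x=xyx$. A non-regular semigroup is called abundant if each of its $\mathcal{L}^*$-classes and each of its $\mathcal{R}^*$-classes contains an idempotent. *)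

(* Defs.v *)
From HB Require Import structures.
From mathcomp Require Import all_boot.

Set Implicit Arguments.
Unset Strict Implicit.
Unset Printing Implicit Defensive.

Local Open Scope group_scope.

Section Abundance.
Variable S : semigroupType.

Definition is_identity (e : S) : Prop := forall x : S, e * x = x /\ x * e = x.

(* S^1 is encoded in option S: Some x is the element x of S, and None is an
   adjoined identity, which belongs to S^1 only if S has no identity. *)
Definition in_S1 (u : option S) : Prop :=
  u = None -> ~ exists e : S, is_identity e.

(* Products a u and u a in S^1, for a in S; they always lie in S. *)
Definition mulS1r (a : S) (u : option S) : S := if u is Some x then a * x else a.
Definition mulS1l (u : option S) (a : S) : S := if u is Some x then x * a else a.

Definition Lstar (a b : S) : Prop :=
  forall x y : option S, in_S1 x -> in_S1 y ->
    (mulS1r a x = mulS1r a y <-> mulS1r b x = mulS1r b y).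

Definition Rstar (a b : S) : Prop :=
  forall x y : option S, in_S1 x -> in_S1 y ->
    (mulS1l x a = mulS1l y a <-> mulS1l x b = mulS1l y b).

Definition idempotent_elt (e : S) : Prop := e * e = e.

Definition regular_semigroup : Prop :=
  forall x : S, exists y : S, x = x * y * x.

(* Abundance is, by convention, only attributed to non-regular semigroups. *)
Definition abundant : Prop :=
  [/\ ~ regular_semigroup,
      forall a : S, exists2 e : S, idempotent_elt e & Lstar a e
    & forall a : S, exists2 e : S, idempotent_elt e & Rstar a e].

End Abundance.

(* The chain {1 < ... < n} is represented by the order-isomorphic chain
   'I_n = {0 < ... < n-1}; r x = None means that x is not in the domain of r. *)
Record ptrans (n : nat) := PTrans { ptrans_fun :> {ffun 'I_n -> option 'I_n} }.

HB.instance Definition _ n := [isNew for @ptrans_fun n].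
HB.instance Definition _ n := [Finite of ptrans n by <:].

Section PartialTransformations.
Variable n : nat.
Implicit Types r s t : ptrans n.

(* Maps act on the right, so x (r s) = (x r) s. *)
Definition ptrans_mul r s : ptrans n := PTrans [ffun x => obind s (r x)].
Definition ptrans_one : ptrans n := PTrans [ffun x => Some x].

Lemma ptransP r s : r =1 s -> r = s.
Proof. by move=> rs; apply/val_inj/ffunP. Qed.

Lemma ptrans_mulA : associative ptrans_mul.
Proof.
by move=> r s t; apply: ptransP => x; rewrite !ffunE; case: (r x) => //= y; rewrite ffunE.
Qed.

Lemma ptrans_mul1 : left_id ptrans_one ptrans_mul.
Proof. by move=> r; apply: ptransP => x; rewrite !ffunE. Qed.

Lemma ptrans_mulr1 : right_id ptrans_one ptrans_mul.
Proof.
by move=> r; apply: ptransP => x; rewrite !ffunE; case: (r x) => //= y; rewrite ffunE.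
Qed.

HB.instance Definition _ :=
  isMonoid.Build (ptrans n) ptrans_mulA ptrans_mul1 ptrans_mulr1.

Definition isotone r : bool :=
  [forall x, forall y, forall u, forall v,
     [&& r x == Some u, r y == Some v & x <= y] ==> (u <= v)].

Definition antitone r : bool :=
  [forall x, forall y, forall u, forall v,
     [&& r x == Some u, r y == Some v & x <= y] ==> (v <= u)].

Definition monotone r : bool := isotone r || antitone r.

Definition decreasing r : bool :=
  [forall x, forall u, (r x == Some u) ==> (u <= x)].

Definition dorp : {pred ptrans n} := [pred r | monotone r && decreasing r].

Lemma isotoneP r : reflect
  (forall x y u v, r x = Some u -> r y = Some v -> x <= y -> u <= v) (isotone r).
Proof.
apply: (iffP idP) => [H x y u v rx ry xy|H].
  move/forallP/(_ x)/forallP/(_ y)/forallP/(_ u)/forallP/(_ v)/implyP: H.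
  by apply; rewrite rx ry xy !eqxx.
apply/forallP=> x; apply/forallP=> y; apply/forallP=> u; apply/forallP=> v.
by apply/implyP=> /and3P[/eqP rx /eqP ry]; apply: H.
Qed.

Lemma antitoneP r : reflect
  (forall x y u v, r x = Some u -> r y = Some v -> x <= y -> v <= u) (antitone r).
Proof.
apply: (iffP idP) => [H x y u v rx ry xy|H].
  move/forallP/(_ x)/forallP/(_ y)/forallP/(_ u)/forallP/(_ v)/implyP: H.
  by apply; rewrite rx ry xy !eqxx.
apply/forallP=> x; apply/forallP=> y; apply/forallP=> u; apply/forallP=> v.
by apply/implyP=> /and3P[/eqP rx /eqP ry]; apply: H.
Qed.

Lemma decreasingP r :
  reflect (forall x u, r x = Some u -> u <= x) (decreasing r).
Proof.
apply: (iffP idP) => [H x u rx|H].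
  by move/forallP/(_ x)/forallP/(_ u)/implyP: H; apply; rewrite rx.
by apply/forallP=> x; apply/forallP=> u; apply/implyP=> /eqP; apply: H.
Qed.

Lemma ptrans_mulP r s x w :
  (r * s) x = Some w -> exists2 u, r x = Some u & s u = Some w.
Proof. by rewrite ffunE; case: (r x) => //= u sw; exists u. Qed.

Lemma dorp_monoid_closed : monoid_closed dorp.
Proof.
split=> [|r s].
  rewrite inE; apply/andP; split.
    by apply/orP; left; apply/isotoneP=> x y u v; rewrite !ffunE => -[<-] [<-].
  by apply/decreasingP=> x u; rewrite ffunE => -[<-].
rewrite !inE => /andP[mr /decreasingP dr] /andP[ms /decreasingP ds].
apply/andP; split; last first.
  apply/decreasingP=> x w /ptrans_mulP[u rx su].
  exact: leq_trans (ds _ _ su) (dr _ _ rx).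
case/orP: mr => [/isotoneP|/antitoneP] mr;
  case/orP: ms => [/isotoneP|/antitoneP] ms.
- apply/orP; left; apply/isotoneP=> x y u v.
  move=> /ptrans_mulP[a ra sa] /ptrans_mulP[b rb sb] xy.
  exact: ms sa sb (mr _ _ _ _ ra rb xy).
- apply/orP; right; apply/antitoneP=> x y u v.
  move=> /ptrans_mulP[a ra sa] /ptrans_mulP[b rb sb] xy.
  exact: ms sa sb (mr _ _ _ _ ra rb xy).
- apply/orP; right; apply/antitoneP=> x y u v.
  move=> /ptrans_mulP[a ra sa] /ptrans_mulP[b rb sb] xy.
  exact: ms sb sa (mr _ _ _ _ ra rb xy).
- apply/orP; left; apply/isotoneP=> x y u v.
  move=> /ptrans_mulP[a ra sa] /ptrans_mulP[b rb sb] xy.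
  exact: ms sb sa (mr _ _ _ _ ra rb xy).
Qed.

End PartialTransformations.

Record DORP (n : nat) := MkDORP { dorp_val :> ptrans n; dorpP : dorp dorp_val }.

HB.instance Definition _ n := [isSub for @dorp_val n].
HB.instance Definition _ n := [Finite of DORP n by <:].
HB.instance Definition _ n :=
  SubChoice_isSubMonoid.Build (ptrans n) (@dorp n) (DORP n)
    (@dorp_monoid_closed n).

(* Main.v *)
Require Import Defs.
From mathcomp Require Import all_boot.

(** Two maps with the same image are L*-related, and two maps with the same
    kernel are R*-related. The partial identity on the image of [a] is an
    idempotent with the image of [a]. Since the kernel classes of a monotone map
    are convex in its domain, sending each point of the domain to the minimum of
    its kernel class is an isotone decreasing idempotent with the kernel of [a],
    even when [a] is antitone. The map with graph {(1, 0)} is not regular, as an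
    inverse would have to send 0 to 1. *)

Set Implicit Arguments.
Unset Strict Implicit.
Unset Printing Implicit Defensive.

Local Open Scope group_scope.

Section MonoidStar.
Variable M : monoidType.
Implicit Types (a b : M) (u : option M).

(** The adjoined [None] acts like the unit [1], so in a monoid the tests over S^1 in the star
    relations reduce to tests over its own elements. *)
Lemma mulS1r_odflt a u : mulS1r a u = a * odflt 1 u.
Proof. by case: u => //=; rewrite mulg1. Qed.

Lemma mulS1l_odflt a u : mulS1l u a = odflt 1 u * a.
Proof. by case: u => //=; rewrite mul1g. Qed.

Lemma Lstar_monoid a b :
  (forall x y : M, a * x = a * y <-> b * x = b * y) -> Lstar a b.
Proof. by move=> ab x y _ _; rewrite !mulS1r_odflt. Qed.

Lemma Rstar_monoid a b :
  (forall x y : M, x * a = y * a <-> x * b = y * b) -> Rstar a b.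
Proof. by move=> ab x y _ _; rewrite !mulS1l_odflt. Qed.

End MonoidStar.

Section PartialTransformations.
Variable n : nat.
Implicit Types (r s t : ptrans n) (A : {set 'I_n}).

Lemma ptrans_mulE r s x : (r * s) x = obind s (r x).
Proof. by rewrite ffunE. Qed.

Lemma eq_mull_imP r s t :
  r * s = r * t <-> forall x i, r x = Some i -> s i = t i.
Proof.
split=> [rst x i rx|st]; last first.
  by apply: ptransP => x; rewrite !ptrans_mulE; case E: (r x) => [i|] //=; apply: st E.
by move: (congr1 (fun f : ptrans n => f x) rst); rewrite /= !ptrans_mulE rx.
Qed.

Definition ptrans_im r : {set 'I_n} := [set i | [exists x, r x == Some i]].

Lemma ptrans_imP r i : reflect (exists x, r x = Some i) (i \in ptrans_im r).
Proof. by rewrite inE; apply: (iffP existsP) => -[x /eqP rx]; exists x. Qed.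

Definition partial_id A : ptrans n :=
  PTrans [ffun x => if x \in A then Some x else None].

Lemma partial_id_Some A x y : partial_id A x = Some y <-> x \in A /\ y = x.
Proof. by rewrite ffunE; case: (x \in A); [split=> [[->]|[_ ->]] | split=> [|[]]]. Qed.

Lemma partial_id_idem A : partial_id A * partial_id A = partial_id A.
Proof.
apply: ptransP => x; rewrite ptrans_mulE.
by case E: (partial_id A x) => [y|] //=; case/partial_id_Some: (E) => _ yx; rewrite yx in E *.
Qed.

Lemma partial_id_dorp A : dorp (partial_id A).
Proof.
apply/andP; split; last by apply/decreasingP=> x u /partial_id_Some[_ ->].
apply/orP; left; apply/isotoneP=> x y u v.
by move=> /partial_id_Some[_ ->] /partial_id_Some[_ ->].
Qed.

(** By [eq_mull_imP], each equation says that [s] and [t] agree on the image of the left factor, and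
    both left factors have the same image. *)
Lemma eq_mull_partial_id r s t :
  r * s = r * t <-> partial_id (ptrans_im r) * s = partial_id (ptrans_im r) * t.
Proof.
split=> /eq_mull_imP st; apply/eq_mull_imP=> x i.
  by case/partial_id_Some=> /ptrans_imP[y ry] ->; apply: st ry.
by move=> rx; apply: (st i i); apply/partial_id_Some; split=> //; apply/ptrans_imP; exists x.
Qed.

(** Extending a map by [None] to [None] lets its kernel record the domain too: points outside the
    domain are identified with [None]. Pointwise, [t * r = u * r] says that this kernel relates
    [t x] and [u x]. *)
Lemma eq_mulr_ker r s : (forall i j, oapp r None i = oapp r None j <->
    oapp s None i = oapp s None j) ->
  forall t u, t * r = u * r <-> t * s = u * s.
Proof.
move=> rs t u; split=> tu; apply: ptransP => x;
  move: (congr1 (fun f : ptrans n => f x) tu); rewrite /= !ptrans_mulE;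
  by move/rs.
Qed.

(** Outside the domain of [r] this is the least undefined point, a value that [ker_proj]
    discards. *)
Definition ker_min r x : 'I_n := [arg min_(j < x | r j == r x) j].

Lemma ker_minE r x : r (ker_min r x) = r x.
Proof. by rewrite /ker_min; case: arg_minnP => // j /eqP. Qed.

Lemma ker_min_le r x j : r j = r x -> ker_min r x <= j.
Proof. by move=> rj; rewrite /ker_min; case: arg_minnP => // k _; apply; apply/eqP. Qed.

Lemma eq_ker_min r x y : r x = r y -> ker_min r x = ker_min r y.
Proof.
by move=> rxy; apply/val_inj/anti_leq; rewrite !ker_min_le // ker_minE.
Qed.

Definition ker_proj r : ptrans n :=
  PTrans [ffun x => if r x is Some _ then Some (ker_min r x) else None].

Lemma ker_proj_Some r x y :
  ker_proj r x = Some y <-> r x <> None /\ y = ker_min r x.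
Proof. by rewrite ffunE; case: (r x) => [u|]; [split=> [[->]|[_ ->]] | split=> [|[]]]. Qed.

Lemma ker_proj_idem r : ker_proj r * ker_proj r = ker_proj r.
Proof.
apply: ptransP => x; rewrite ptrans_mulE.
case E: (ker_proj r x) => [y|] //=; case/ker_proj_Some: E => rx ->.
by apply/ker_proj_Some; rewrite ker_minE; split=> //; apply/esym/eq_ker_min/ker_minE.
Qed.

Lemma ker_proj_ker r i j : oapp r None i = oapp r None j <->
  oapp (ker_proj r) None i = oapp (ker_proj r) None j.
Proof.
(* [r] factors through [ker_proj r], which gives the backward implication. *)
have rE k : oapp r None k = obind r (oapp (ker_proj r) None k).
  case: k => //= k; rewrite ffunE; case E: (r k) => //=.
  by rewrite ker_minE.
split=> [|e]; last by rewrite !rE e.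
have eN k : r k = None -> ker_proj r k = None by rewrite ffunE => ->.
case: i j => [i|] [j|] //= rij; last 2 first.
- by rewrite eN.
- by rewrite eN.
by rewrite !ffunE rij (eq_ker_min rij).
Qed.

(** In either orientation, the value at [y] is squeezed between the equal values at [x] and [z]. *)
Lemma monotone_ker_convex r (x y z u v : 'I_n) :
    monotone r -> x <= y -> y <= z ->
  r x = Some u -> r y = Some v -> r z = Some u -> v = u.
Proof.
move=> mr xy yz rx ry rz; apply/val_inj/anti_leq/andP.
by case/orP: mr => [/isotoneP|/antitoneP] mr; split;
  first [exact: mr rx ry xy | exact: mr ry rz yz].
Qed.

Lemma ker_proj_isotone r : monotone r -> isotone (ker_proj r).
Proof.
move=> mr; apply/isotoneP=> x y u v.
move=> /ker_proj_Some[rx ->] /ker_proj_Some[ry ->] xy.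
case/orP: (leq_total (ker_min r x) (ker_min r y)) => // le_yx.
(* In the remaining case the minimum for [x] lies between the minimum for [y] and [y] itself, so by
   convexity [x] and [y] share a kernel class. *)
have le_y : ker_min r x <= y by apply: leq_trans xy; apply: ker_min_le.
case Ex: (r x) rx => [w|] // _; case Ey: (r y) ry => [w'|] // _.
apply: ker_min_le; rewrite ker_minE Ex Ey; congr Some; apply/esym.
by apply: (monotone_ker_convex mr le_yx le_y _ _ Ey); rewrite ker_minE.
Qed.

Lemma ker_proj_dorp r : monotone r -> dorp (ker_proj r).
Proof.
move=> mr; rewrite /dorp /= /monotone ker_proj_isotone //=.
by apply/decreasingP=> x u /ker_proj_Some[_ ->]; apply: ker_min_le.
Qed.

Definition ptrans_single (i j : 'I_n) : ptrans n :=
  PTrans [ffun x => if x == i then Some j else None].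

Lemma ptrans_single_Some i j x y :
  ptrans_single i j x = Some y -> x = i /\ y = j.
Proof. by rewrite ffunE; case: eqP => // -> [->]. Qed.

Lemma ptrans_single_dorp (i j : 'I_n) : j <= i -> dorp (ptrans_single i j).
Proof.
move=> ji; apply/andP; split.
  apply/orP; left; apply/isotoneP=> x y u v.
  by move=> /ptrans_single_Some[_ ->] /ptrans_single_Some[_ ->].
by apply/decreasingP=> x u /ptrans_single_Some[-> ->].
Qed.

End PartialTransformations.

Section DORP.
Variable n : nat.
Implicit Types a b x y : DORP n.

(** Transfers equations to the ambient monoid of partial maps, where the image and kernel criteria
    are stated. *)
Lemma dorp_mul_eq a b x y :
  a * x = b * y <-> dorp_val a * dorp_val x = dorp_val b * dorp_val y.
Proof. by split=> [/(congr1 (@dorp_val n))|ab]; [|exact: val_inj]. Qed.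

Lemma dorp_Lstar_idempotent a : exists2 e, idempotent_elt e & Lstar a e.
Proof.
exists (MkDORP (partial_id_dorp (ptrans_im a))).
  by apply: val_inj; apply: partial_id_idem.
have im_eq := eq_mull_partial_id (dorp_val a).
by apply: Lstar_monoid => x y; split=> /dorp_mul_eq/im_eq xy; apply/dorp_mul_eq.
Qed.

Lemma dorp_Rstar_idempotent a : exists2 e, idempotent_elt e & Rstar a e.
Proof.
have /andP[ma _] := dorpP a.
exists (MkDORP (ker_proj_dorp ma)); first by apply: val_inj; apply: ker_proj_idem.
have ker_eq := eq_mulr_ker (ker_proj_ker (dorp_val a)).
by apply: Rstar_monoid => x y; split=> /dorp_mul_eq/ker_eq xy; apply/dorp_mul_eq.
Qed.

Lemma dorp_not_regular : 2 <= n -> ~ regular_semigroup (DORP n).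
Proof.
move=> n2 reg.
pose i0 := Ordinal (ltnW n2); pose i1 := Ordinal n2.
pose s := ptrans_single i1 i0.
have [b /(congr1 (@dorp_val n)) sbs] :=
  reg (MkDORP (ptrans_single_dorp (leq0n i1 : i0 <= i1))).
have : s i1 = Some i0 by rewrite ffunE eqxx.
(* Traced from [i1], the product passes through [i0], which [b] must then send up to [i1], the only
   domain point of [s]; but [b] is decreasing. *)
rewrite (sbs : s = s * dorp_val b * s) => /ptrans_mulP[k].
case/ptrans_mulP=> j /ptrans_single_Some[_ ->] bk /ptrans_single_Some[k1 _].
have /andP[_ /decreasingP db] := dorpP b.
by have := db _ _ bk; rewrite k1.
Qed.

End DORP.

Theorem theorem2p10 (n : nat) (hn : 2 <= n) : abundant (DORP n).
Proof.
split; first exact: dorp_not_regular.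
- exact: dorp_Lstar_idempotent.
- exact: dorp_Rstar_idempotent.
Qed.
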